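(* On every instance of $\mathsf{3\,CSP\!-\!2}$ with strong chromatic number $\nu\geq 3$, the average differential ratio is at least $1/(4\lceil\nu/2\rceil)$, a quantity asymptotically equivalent to $1/(2\nu)$ (as $\nu\to\infty$).
   Context: Let $\Sigma_q=\{0,1,\ldots,q-1\}$ and $[n]=\{1,\ldots,n\}$. An instance $I$ of $\mathsf{k\,CSP\!-\!q}$ (here $k=3$, $q=2$) consists of integers $n,m\ge 1$, a goal (maximize or minimize) and, for each $i\in[m]$, a weight $w_i>0$, an integer $1\le k_i\leq \min\{k,n\}$, a strictly increasing sequence $J_i=(i_1,\ldots,i_{k_i})$ of indices of $[n]$, and a function $P_i:\Sigma_q^{k_i}\to\mathbb{R}$. Solutions are vectors $x\in\Sigma_q^n$, with value $v(I,x)=\sum_{i=1}^m w_iP_i(x_{i_1},\ldots,x_{i_{k_i}})$. $\mathrm{opt}(I)$ and $\mathrm{wor}(I)$ are the best and worst solution values (maximum and minimum of $v(I,\cdot)$ if maximizing, minimum and maximum if minimizing). The average differential ratio on $I$ is $(\mathbb{E}_X[v(I,X)]-\mathrm{wor}(I))/(\mathrm{opt}(I)-\mathrm{wor}(I))$ with $X$ uniform on $\Sigma_q^n$ (considered when $\mathrm{opt}(I)\neq\mathrm{wor}(I)$). The strong chromatic number of $I$ is the smallest $\nu$ such that there is a partition of $[n]$ into $\nu$ sets such that each $J_i$ contains at most one index from each set. *)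

(* Defs.v *)
From mathcomp Require Import all_boot all_order all_algebra.
From mathcomp Require Import reals.
Set Implicit Arguments.
Unset Strict Implicit.
Unset Printing Implicit Defensive.
Import Order.TTheory GRing.Theory Num.Theory.
Local Open Scope ring_scope.

(* The alphabet {0, ..., q-1} is 'I_q, and the index set [n] is 'I_n, so that
   variables are numbered from 0. *)
Definition solution (q n : nat) := {ffun 'I_n -> 'I_q}.

Record constraint (R : realType) (k q n : nat) := Constraint {
  weight : R;
  weight_gt0 : 0 < weight;
  arity : nat;
  arity_gt0 : (1 <= arity)%N;
  arity_le : (arity <= minn k n)%N;
  scope : 'I_arity -> 'I_n;
  scope_incr : forall a b : 'I_arity, (a < b)%N -> (scope a < scope b)%N;
  payoff : {ffun 'I_arity -> 'I_q} -> R
}.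
Arguments scope {R k q n} c a : rename.
Arguments payoff {R k q n} c y : rename.

Inductive goal := Maximize | Minimize.

Record instance (R : realType) (k q : nat) := Instance {
  nvars : nat;
  nvars_gt0 : (1 <= nvars)%N;
  nconstraints : nat;
  nconstraints_gt0 : (1 <= nconstraints)%N;
  objective : goal;
  constraints : 'I_nconstraints -> constraint R k q nvars
}.
Arguments constraints {R k q} I i : rename.

Definition restrict (R : realType) (k q n : nat) (c : constraint R k q n)
    (x : solution q n) : {ffun 'I_(arity c) -> 'I_q} :=
  [ffun a => x (scope c a)].

Definition value (R : realType) (k q : nat) (I : instance R k q)
    (x : solution q (nvars I)) : R :=
  \sum_i weight (constraints I i) *
         payoff (constraints I i) (restrict (constraints I i) x).
Arguments value {R k q} I x.

(* The alphabet size is a successor from here on, which makes the solution set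
   nonempty: the value of the all-zero solution initializes the max and min. *)
Definition max_value (R : realType) (k q : nat) (I : instance R k q.+1) : R :=
  \big[Num.max/value I [ffun=> ord0]]_(x : solution q.+1 (nvars I))
    value I x.

Definition min_value (R : realType) (k q : nat) (I : instance R k q.+1) : R :=
  \big[Num.min/value I [ffun=> ord0]]_(x : solution q.+1 (nvars I))
    value I x.

Definition opt (R : realType) (k q : nat) (I : instance R k q.+1) : R :=
  if objective I is Maximize then max_value I else min_value I.

Definition wor (R : realType) (k q : nat) (I : instance R k q.+1) : R :=
  if objective I is Maximize then min_value I else max_value I.

Definition average_value (R : realType) (k q : nat) (I : instance R k q) : R :=
  (\sum_(x : solution q (nvars I)) value I x) / #|{: solution q (nvars I)}|%:R.

Definition average_differential_ratio (R : realType) (k q : nat)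
    (I : instance R k q.+1) : R :=
  (average_value I - wor I) / (opt I - wor I).

Definition support (R : realType) (k q n : nat) (c : constraint R k q n) :
    {set 'I_n} :=
  [set scope c a | a : 'I_(arity c)].

Definition strong_coloring (R : realType) (k q : nat) (I : instance R k q)
    (P : {set {set 'I_(nvars I)}}) : bool :=
  partition P [set: 'I_(nvars I)] &&
  [forall i, forall B in P, (#|support (constraints I i) :&: B| <= 1)%N].

Definition strongly_colorable (R : realType) (k q : nat) (I : instance R k q)
    (nu : nat) : bool :=
  [exists P : {set {set 'I_(nvars I)}}, strong_coloring P && (#|P| == nu)].

Lemma strongly_colorable_ex (R : realType) (k q : nat) (I : instance R k q) :
  exists nu, strongly_colorable I nu.
Proof.
pose P := preim_partition (@id 'I_(nvars I)) [set: 'I_(nvars I)].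
exists #|P|; apply/existsP; exists P; rewrite eqxx andbT.
have partP : partition P [set: 'I_(nvars I)] by exact: preim_partitionP.
apply/andP; split=> //; apply/forallP => i; apply/forall_inP => B.
case/imsetP => x _ ->.
rewrite -(cards1 x); apply/subset_leq_card/subsetP => y.
by rewrite !inE => /andP[_ /eqP ->].
Qed.

Definition strong_chromatic_number (R : realType) (k q : nat)
    (I : instance R k q) : nat :=
  ex_minn (strongly_colorable_ex I).

(* Main.v *)
Require Import Defs.
From mathcomp Require Import all_boot all_order all_algebra fingroup perm.
From mathcomp Require Import reals zify ring lra.
Import Order.TTheory GRing.Theory Num.Theory.
Local Open Scope ring_scope.
Set Implicit Arguments.
Unset Strict Implicit.

(** Let h = ceil(nu / 2), and let T be a set of 2h colours, so that the indices
    can be coloured by T with the indices of every constraint getting distinct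
    colours.  From a solution x, flipping the bits x_j of all indices j whose
    colour lies in a random set A of colours gives a random solution.  The law
    of A puts mass 1/(4h) on the empty set, mass 1/(4h) on T, and spreads the
    rest evenly over the sets of size h.

    Two properties of this law give the ratio.  The empty set has mass 1/(4h),
    so x itself is drawn with at least that probability.  And the law is
    3-wise uniform: the membership in A of any three distinct colours is
    distributed as three fair independent coins ([mean_preimset]).  As a
    constraint sees at most three variables, all of distinct colours, the
    expected value of the random solution is the average value of the instance
    ([mean_value_flip]).  Taking x optimal, the average value is then at least
    a mixture of the optimal value, with coefficient 1/(4h), and of the worst
    value, with coefficient 1 - 1/(4h).

    For 3-wise uniformity it is enough that the characters of T of order 1, 2
    and 3 have mean zero ([mean_character]).  Those of odd order do because the
    law is invariant under complement.  For order 2, write s_i = (-1)^[i in A]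
    and fix a colour i.  The product of s_i with the sum of all the s_j
    vanishes on sets of size h and is 2h on the two extreme sets, of total mass
    1/(2h), so its mean is 1.  The term j = i already contributes 1, and the
    other terms have equal means by symmetry among the colours; hence these
    means are zero ([mean_character_pair]). *)

(** * A three-wise uniform law on the subsets of an even set *)

(** The Fourier basis of the functions on the subsets of T, viewed as bit
    vectors. *)
Definition character (R : realFieldType) (T : finType) (X A : {set T}) : R :=
  \prod_(i in X) (-1) ^+ (i \in A).
Arguments character {R T} X A.

(** With the other sets all of half size, a total mass of 1 / #|T| on the two
    extreme sets is the one that makes distinct colours uncorrelated. *)
Definition balanced_mass (R : realFieldType) (T : finType) (A : {set T}) : R :=
  ((A == set0)%:R + (A == [set: T])%:R) / (2 * #|T|%:R)
  + (#|A|.*2 == #|T|)%:R * ((1 - #|T|%:R^-1) / 'C(#|T|, #|T|./2)%:R).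
Arguments balanced_mass {R T} A.

Definition balanced_mean (R : realFieldType) (T : finType)
    (f : {set T} -> R) : R :=
  \sum_A balanced_mass A * f A.
Arguments balanced_mean {R T} f.

Lemma sum_mul_eqb (R : pzSemiRingType) (T : finType) (x : T) (f : T -> R) :
  \sum_y (y == x)%:R * f y = f x.
Proof.
rewrite (bigD1 x) //= eqxx mul1r big1 ?addr0 // => y /negPf ->.
by rewrite mul0r.
Qed.

Lemma mean_split (R : realFieldType) (T : finType) (f : {set T} -> R) :
  balanced_mean f = (f set0 + f [set: T]) / (2 * #|T|%:R) +
    (1 - #|T|%:R^-1) / 'C(#|T|, #|T|./2)%:R *
    \sum_(A : {set T} | #|A|.*2 == #|T|) f A.
Proof.
rewrite /balanced_mean /balanced_mass.
under eq_bigr do rewrite mulrDl mulrAC mulrDl.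
rewrite big_split /= -mulr_suml big_split /= !sum_mul_eqb; congr (_ + _).
rewrite [in RHS]big_mkcond mulr_sumr; apply: eq_bigr => A _.
by case: eqP => _; rewrite ?mul1r // mul0r mul0r mulr0.
Qed.

Lemma mass_total (R : realFieldType) (T : finType) :
  (0 < #|T|)%N -> ~~ odd #|T| -> \sum_(A : {set T}) balanced_mass A = 1 :> R.
Proof.
move=> T0 Teven; under eq_bigr do rewrite -[balanced_mass _]mulr1.
rewrite -[LHS]/(balanced_mean (fun=> 1)) mean_split sumr_const.
have -> : #|[pred A : {set T} | #|A|.*2 == #|T|]| = 'C(#|T|, #|T|./2).
  rewrite -card_draws -cardsE; apply: eq_card => A; rewrite !inE.
  by rewrite -[in LHS](even_halfK Teven) (inj_eq double_inj).
have C0 : ('C(#|T|, #|T|./2)%:R : R) != 0.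
  by rewrite pnatr_eq0 -lt0n bin_gt0 -{2}(even_halfK Teven) -addnn leq_addr.
have n0 : (#|T|%:R : R) != 0 by rewrite pnatr_eq0 -lt0n.
by field; rewrite C0 n0.
Qed.

Lemma eq_mass (R : realFieldType) (T : finType) (A B : {set T}) :
  #|A| = #|B| -> balanced_mass A = balanced_mass B :> R.
Proof.
by move=> cAB; rewrite /balanced_mass -!cards_eq0 !eqEcard !subsetT cAB.
Qed.

Lemma mass_setC (R : realFieldType) (T : finType) (A : {set T}) :
  balanced_mass (~: A) = balanced_mass A :> R.
Proof.
have eqC (B D : {set T}) : (~: B == D) = (B == ~: D).
  by rewrite (can2_eq (@setCK _) (@setCK _)).
rewrite /balanced_mass !eqC setC0 setCT [_%:R + _%:R]addrC.
congr (_ + _%:R * _).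
have := cardsC A; rewrite -!addnn => <-; congr (nat_of_bool _); lia.
Qed.

Lemma mean_setC (R : realFieldType) (T : finType) (f : {set T} -> R) :
  balanced_mean (fun A => f (~: A)) = balanced_mean f.
Proof.
rewrite /balanced_mean [RHS](reindex_inj (@setC_inj T)).
by apply: eq_bigr => A _; rewrite mass_setC.
Qed.

(** Used to exchange two colours while fixing a third one. *)
Lemma mean_tperm (R : realFieldType) (T : finType) (j k : T)
    (f : {set T} -> R) :
  balanced_mean (fun A => f (tperm j k @^-1: A)) = balanced_mean f.
Proof.
have preK : involutive (fun A : {set T} => tperm j k @^-1: A).
  by move=> A; apply/setP => i; rewrite !inE tpermK.
rewrite /balanced_mean [RHS](reindex_inj (inv_inj preK)); apply: eq_bigr => A _.
congr (_ * _); apply: eq_mass.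
by rewrite -(can_imset_pre A (tpermK j k)) card_imset //; apply: perm_inj.
Qed.

Lemma character_setC (R : realFieldType) (T : finType) (X A : {set T}) :
  character X (~: A) = (-1) ^+ #|X| * character X A :> R.
Proof.
rewrite -prodr_const -big_split; apply: eq_bigr => i _ /=.
by rewrite inE; case: (i \in A); rewrite ?expr1 ?expr0 ?mulr1 ?mulrNN ?mulr1.
Qed.

(** Complementing the set preserves the law but negates an odd character. *)
Lemma mean_character_odd (R : realFieldType) (T : finType) (X : {set T}) :
  odd #|X| -> balanced_mean (character X) = 0 :> R.
Proof.
move=> oddX; apply/eqP.
rewrite -eqNr -[in eqbRHS]mean_setC /balanced_mean -sumrN.
apply/eqP/eq_bigr => A _.
by rewrite character_setC -signr_odd oddX mulN1r mulrN.
Qed.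

Lemma sum_signs (R : realFieldType) (T : finType) (A : {set T}) :
  \sum_i (-1) ^+ (i \in A) = #|T|%:R - #|A|.*2%:R :> R.
Proof.
have sgnE (b : bool) : (-1) ^+ b = 1 - b%:R *+ 2 :> R by case: b => /=; ring.
under eq_bigr do rewrite sgnE.
rewrite big_split /= sumr_const sumrN sumrMnl -natr_sum -muln2 natrM mulr_natr.
by rewrite -(sum1_card (mem A)) [in RHS]big_mkcond.
Qed.

(** The correlations of a fixed colour i with all the colours, itself included,
    add up to 1, which is its correlation with itself; the others are equal by
    symmetry, hence all zero.  The weight of the two extreme sets is tuned for
    that sum to be 1. *)
Lemma mean_character_pair (R : realFieldType) (T : finType) (i j : T) :
  ~~ odd #|T| -> i != j -> balanced_mean (character [set i; j]) = 0 :> R.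
Proof.
move=> Teven ij.
have T0 : (0 < #|T|)%N by apply/card_gt0P; exists i.
have n0 : (#|T|%:R : R) != 0 by rewrite pnatr_eq0 -lt0n.
pose c k : R := balanced_mean (fun A => (-1) ^+ (i \in A) * (-1) ^+ (k \in A)).
have -> : balanced_mean (character [set i; j]) = c j.
  by apply: eq_bigr => A _; rewrite /character big_setU1 ?inE //= big_set1.
have ci : c i = 1.
  rewrite -(mass_total R T0 Teven); apply: eq_bigr => A _.
  by case: (i \in A); rewrite ?expr1 ?mulrNN !mulr1.
have cE k : k != i -> c k = c j.
  move=> ki; rewrite /c -(mean_tperm k j); apply: eq_bigr => A _.
  by rewrite !inE tpermL tpermD // eq_sym.
have : \sum_k c k = 1.
  rewrite exchange_big /=.
  under eq_bigr do rewrite -mulr_sumr -mulr_sumr sum_signs.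
  rewrite -/(balanced_mean
               (fun A => (-1) ^+ (i \in A) * (#|T|%:R - #|A|.*2%:R))).
  (* Sets of half size contribute nothing: their signs cancel out. *)
  rewrite mean_split big1 => [|A /eqP ->]; last by rewrite subrr mulr0.
  by rewrite !inE cards0 cardsT mulr0 addr0 -!muln2 !natrM expr0 expr1; field.
rewrite (bigD1 i) //= ci => /eqP; rewrite -subr_eq0 addrAC subrr add0r.
under eq_bigr => k ki do rewrite cE //.
rewrite sumr_const mulrn_eq0 cardC1 => /orP[|/eqP //].
have : (1 < #|T|)%N by apply/card_gt1P; exists i, j.
by case: #|T| => [|[|n]].
Qed.

Lemma mean_character (R : realFieldType) (T : finType) (X : {set T}) :
  (0 < #|T|)%N -> ~~ odd #|T| -> (#|X| <= 3)%N ->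
  balanced_mean (character X) = (X == set0)%:R :> R.
Proof.
move=> T0 Teven X3; have [->|X0] := eqVneq X set0.
  rewrite -(mass_total R T0 Teven).
  by apply: eq_bigr => A _; rewrite /character big_set0 mulr1.
have [oddX|evenX] := boolP (odd #|X|); first exact: mean_character_odd.
have /eqP/cards2P[i [j [ij ->]]] : #|X| = 2.
  by move: X0 X3 evenX; rewrite -cards_eq0; case: #|X| => [|[|[|[|]]]].
exact: mean_character_pair.
Qed.

(** Orthogonality of the characters, from the expansion of the product over i of
    1 + (-1)^[i in A] (-1)^[i in B], whose factors are 2 where A and B agree
    and 0 elsewhere. *)
Lemma sum_character (R : realFieldType) (T : finType) (A B : {set T}) :
  \sum_X character X A * character X B = 2 ^+ #|T| * (A == B)%:R :> R.
Proof.
under eq_bigr => X _.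
  rewrite /character -big_split /= big_mkcond.
  over.
rewrite -(bigA_distr _ _ (fun i => (-1) ^+ (i \in A) * (-1) ^+ (i \in B))
                         (fun=> 1)) /=.
have [->|/eqP AB] := eqVneq A B.
  rewrite mulr1 -prodr_const; apply: eq_bigr => i _.
  by case: (i \in B); rewrite ?expr1 ?mulrNN !mulr1.
have [i /negPf ABi] : exists i, (i \in A) != (i \in B).
  apply/existsP; rewrite -negb_forall; apply/negP => /forallP AB'.
  by apply: AB; apply/setP => i; apply/eqP.
rewrite mulr0 (bigD1 i) //=.
by case: (i \in A) (i \in B) ABi => [] [] // _;
  rewrite ?expr1 ?mulr1 ?mul1r addNr mul0r.
Qed.

(** Three-wise uniformity: seen through at most three distinct colours, the law
    is the uniform one.  It holds by expanding F in characters of S: g carries a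
    character of S of order at most 3 to a character of T of the same order, and
    only the trivial one has a nonzero mean. *)
Lemma mean_preimset (R : realFieldType) (S T : finType) (g : S -> T)
    (F : {set S} -> R) :
  (0 < #|T|)%N -> ~~ odd #|T| -> (#|S| <= 3)%N -> injective g ->
  balanced_mean (fun A => F (g @^-1: A)) = (\sum_B F B) / 2 ^+ #|S|.
Proof.
move=> T0 Teven S3 g_inj.
have mean_chi X :
    balanced_mean (fun A => character X (g @^-1: A)) = (X == set0)%:R :> R.
  rewrite -(imset_eq0 g) -mean_character // ?card_imset //; last first.
    exact: leq_trans (max_card _) S3.
  apply: eq_bigr => A _; rewrite /character big_imset /=; last first.
    by move=> ? ? _ _; apply: g_inj.
  by under eq_bigr do rewrite inE.
apply: (canRL (mulfK _)); first by rewrite expf_neq0 // pnatr_eq0.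
rewrite /balanced_mean mulr_suml.
transitivity (\sum_A balanced_mass A * \sum_B \sum_X F B *
               (character X B * character X (g @^-1: A))).
  apply: eq_bigr => A _; rewrite -mulrA; congr (_ * _).
  under eq_bigr do rewrite -mulr_sumr sum_character mulrCA.
  by rewrite -mulr_sumr mulrC; congr (_ * _);
     under eq_bigr do rewrite mulrC; rewrite sum_mul_eqb.
under eq_bigr do rewrite mulr_sumr.
rewrite exchange_big; apply: eq_bigr => B _ /=.
under eq_bigr do rewrite mulr_sumr.
rewrite exchange_big /=.
transitivity (\sum_X (X == set0)%:R * (F B * character X B)); last first.
  by rewrite sum_mul_eqb /character big_set0 mulr1.
apply: eq_bigr => X _; rewrite -mean_chi mulr_suml.
by apply: eq_bigr => A _; ring.
Qed.

(** The empty set has mass 1 / (2 #|T|), and f is at least lo on the rest. *)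
Lemma mean_ge (R : realFieldType) (T : finType) (f : {set T} -> R) (lo : R) :
  (0 < #|T|)%N -> ~~ odd #|T| -> (forall A, lo <= f A) ->
  lo + (f set0 - lo) / (2 * #|T|%:R) <= balanced_mean f.
Proof.
move=> T0 Teven lo_le.
have -> : balanced_mean f = lo + balanced_mean (fun A => f A - lo).
  rewrite -[X in _ = X + _]mul1r -(mass_total R T0 Teven) mulr_suml.
  rewrite -big_split /=.
  by apply: eq_bigr => A _; ring.
rewrite lerD2l mean_split [in leRHS]mulrDl -[leRHS]addrA lerDl.
have n1 : #|T|%:R^-1 <= 1 :> R by rewrite invf_le1 ?ltr0n // ler1n.
apply: addr_ge0; first by rewrite divr_ge0 ?subr_ge0 ?mulr_ge0.
apply: mulr_ge0; first by rewrite divr_ge0 ?subr_ge0.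
by apply: sumr_ge0 => A _; rewrite subr_ge0.
Qed.

Lemma mean_le (R : realFieldType) (T : finType) (f : {set T} -> R) (hi : R) :
  (0 < #|T|)%N -> ~~ odd #|T| -> (forall A, f A <= hi) ->
  balanced_mean f <= hi - (hi - f set0) / (2 * #|T|%:R).
Proof.
move=> T0 Teven le_hi.
have lo_le A : - hi <= - f A by rewrite lerN2.
have := mean_ge T0 Teven lo_le.
have -> : balanced_mean (fun A => - f A) = - balanced_mean f.
  by rewrite /balanced_mean -sumrN; apply: eq_bigr => A _; rewrite mulrN.
by rewrite -lerN2 opprK; congr (_ <= _); ring.
Qed.

(** * Flipping the bits of a solution along a colouring *)

Definition flip (T : finType) (y : {ffun T -> 'I_2}) (B : {set T}) :
    {ffun T -> 'I_2} :=
  [ffun i => if i \in B then rev_ord (y i) else y i].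

Lemma flip_set0 (T : finType) (y : {ffun T -> 'I_2}) : flip y set0 = y.
Proof. by apply/ffunP => i; rewrite ffunE inE. Qed.

Lemma flipK (T : finType) (B : {set T}) : involutive (fun y => flip y B).
Proof.
move=> y; apply/ffunP => i; rewrite !ffunE.
by case: (i \in B); rewrite ?rev_ordK.
Qed.

(** Over a two-letter alphabet, a vector is determined by y and by the set of
    positions where it differs from y. *)
Lemma sum_flip (V : nmodType) (T : finType) (y : {ffun T -> 'I_2})
    (F : {ffun T -> 'I_2} -> V) :
  \sum_B F (flip y B) = \sum_z F z.
Proof.
rewrite [RHS](reindex (flip y)) //.
exists (fun z : {ffun T -> 'I_2} => [set i | z i != y i]) => [B|z] _.
  apply/setP => i; rewrite inE ffunE; case: (i \in B); last by rewrite eqxx.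
  by rewrite -val_eqE /=; case: (y i) => [[|[|]]].
apply/ffunP => i; rewrite ffunE inE; apply/val_inj.
by case: (z i) => [[|[|?]] ?]; case: (y i) => [[|[|?]] ?].
Qed.

Lemma restrict_flip (R : realType) (k n : nat) (c : constraint R k 2 n)
    (x : solution 2 n) (B : {set 'I_n}) :
  restrict c (flip x B) = flip (restrict c x) (scope c @^-1: B).
Proof. by apply/ffunP => a; rewrite !ffunE inE. Qed.

(** Each constraint sees at most three variables, of distinct colours, so it
    sees uniformly random bits.  The mean is thus the same number K for every x, and
    averaging over x identifies K with the average value, because flipping along
    a fixed set permutes the solutions. *)
Lemma mean_value_flip (R : realType) (I : instance R 3 2) (T : finType)
    (col : 'I_(nvars I) -> T) (x : solution 2 (nvars I)) :
  (0 < #|T|)%N -> ~~ odd #|T| ->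
  (forall i, injective (col \o scope (constraints I i))) ->
  balanced_mean (fun A => value I (flip x (col @^-1: A))) = average_value I.
Proof.
move=> T0 Teven col_inj.
pose K := \sum_i weight (constraints I i) *
  ((\sum_z payoff (constraints I i) z) / 2 ^+ arity (constraints I i)).
have meanK y : balanced_mean (fun A => value I (flip y (col @^-1: A))) = K.
  rewrite /balanced_mean /value; under eq_bigr do rewrite mulr_sumr.
  rewrite exchange_big /=; apply: eq_bigr => i _.
  set c := constraints I i.
  have c3 : (#|'I_(arity c)| <= 3)%N.
    by rewrite card_ord (leq_trans (arity_le c)) // geq_minl.
  rewrite -[in RHS](sum_flip (restrict c y)) -[in _ ^+ _](card_ord (arity c)).
  rewrite -(@mean_preimset R _ _ _ (fun B => payoff c (flip (restrict c y) B))
             T0 Teven c3 (col_inj i)).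
  rewrite mulr_sumr; apply: eq_bigr => A _.
  rewrite restrict_flip mulrCA; congr (_ * (_ * payoff c (flip _ _))).
  by apply/setP => a; rewrite !inE.
rewrite meanK /average_value; apply: (canRL (mulfK _)).
  by rewrite pnatr_eq0 -lt0n; apply/card_gt0P; exists x.
transitivity (\sum_(y : solution 2 (nvars I)) K).
  by rewrite sumr_const mulr_natr.
under eq_bigr => y _ do rewrite -(meanK y).
rewrite exchange_big /= -[RHS]mul1r -(mass_total R T0 Teven) mulr_suml.
apply: eq_bigr => A _; rewrite -mulr_sumr; congr (_ * _).
by rewrite [RHS](reindex_inj (inv_inj (@flipK _ (col @^-1: A)))).
Qed.

Lemma scope_inj (R : realType) (k q n : nat) (c : constraint R k q n) :
  injective (scope c).
Proof.
move=> a b ab; apply/val_inj.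
by case: (ltngtP a b) => // /scope_incr; rewrite ab ltnn.
Qed.

(** The blocks of a strong colouring, once numbered, become colours; spare
    colours are allowed so that the number of colours can be made even. *)
Lemma strongly_colorable_inj (R : realType) (k q : nat) (I : instance R k q)
    (nu N : nat) :
  strongly_colorable I nu -> (nu <= N)%N ->
  exists col : 'I_(nvars I) -> 'I_N,
    forall i, injective (col \o scope (constraints I i)).
Proof.
case/existsP => P /andP[/andP[partP /forallP colP] /eqP <-] PN.
have inP j : pblock P j \in P.
  by rewrite pblock_mem // (cover_partition partP) inE.
have lt_col j : (index (pblock P j) (enum P) < N)%N.
  by rewrite (leq_trans _ PN) // cardE index_mem mem_enum.
exists (fun j => Ordinal (lt_col j)) => i a b /(congr1 val) /= ab.
have {}ab : pblock P (scope _ a) = pblock P (scope _ b).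
  by apply: (index_inj set0 _ _ ab); rewrite mem_enum ?inP.
have /forall_inP/(_ _ (inP (scope _ a)))/card_le1_eqP col1 := colP i.
have in_block j : j \in pblock P j.
  by rewrite mem_pblock (cover_partition partP) inE.
have in_supp c : scope (constraints I i) c \in Defs.support (constraints I i).
  exact: imset_f.
by apply/scope_inj/col1; rewrite in_setI in_supp ?in_block // ab in_block.
Qed.

(** With the average value expressed as the mean of the values of the flips of
    x, [mean_ge] and [mean_le] bound the value of an arbitrary x, hence the largest
    and the smallest value, in terms of the average value.  The first bound
    serves maximization, the second minimization. *)
Lemma ratio_ge (R : realType) (I : instance R 3 2) (nu h : nat) :
  (0 < h)%N -> strongly_colorable I nu -> (nu <= h.*2)%N -> opt I <> wor I ->
  1 / (4 * h%:R) <= average_differential_ratio I.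
Proof.
move=> h0 colorable nuh.
have [col col_inj] := strongly_colorable_inj colorable nuh.
have T0 : (0 < #|'I_h.*2|)%N by rewrite card_ord double_gt0.
have Teven : ~~ odd #|'I_h.*2| by rewrite card_ord odd_double.
have meanE x := mean_value_flip x T0 Teven col_inj.
have f0 x : value I (flip x (col @^-1: set0)) = value I x.
  by rewrite preimset0 flip_set0.
have N4 : 2 * #|'I_h.*2|%:R = 4 * h%:R :> R.
  by rewrite card_ord -muln2 natrM; ring.
have h4 : 0 < 4 * h%:R :> R by rewrite mulr_gt0 ?ltr0n.
have min_le x : min_value I <= value I x by apply: bigmin_le.
have le_max x : value I x <= max_value I by apply: le_bigmax.
have lower : (max_value I - min_value I) / (4 * h%:R)
             <= average_value I - min_value I.
  rewrite ler_pdivrMr // lerBlDr.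
  have lo x : value I x <= (average_value I - min_value I) * (4 * h%:R)
                           + min_value I.
    rewrite -lerBlDr -ler_pdivrMr // lerBrDl -(meanE x) -{1}(f0 x) -N4.
    by apply: (mean_ge T0 Teven) => A.
  exact: bigmax_le.
have upper : (max_value I - min_value I) / (4 * h%:R)
             <= max_value I - average_value I.
  rewrite ler_pdivrMr // lerBlDr -lerBlDl.
  have hi x : max_value I - (max_value I - average_value I) * (4 * h%:R)
              <= value I x.
    rewrite lerBlDr -lerBlDl -ler_pdivrMr // lerBrDr -lerBrDl -(meanE x).
    rewrite -{1}(f0 x) -N4; exact: (mean_le T0 Teven).
  exact: le_bigmin.
have min_max : min_value I <= max_value I.
  exact: le_trans (min_le [ffun=> ord0]) (le_max _).
rewrite /average_differential_ratio /opt /wor mul1r.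
case: (objective I) => /eqP neq.
  have gap : 0 < max_value I - min_value I.
    by rewrite subr_gt0 lt_neqAle eq_sym neq.
  by rewrite ler_pdivlMr // mulrC.
have gap : 0 < max_value I - min_value I.
  by rewrite subr_gt0 lt_neqAle neq.
rewrite -opprB -[min_value I - _]opprB invrN mulrNN.
by rewrite ler_pdivlMr // mulrC.
Qed.

(** * Asymptotics of the bound *)

From mathcomp Require Import all_classical all_reals all_analysis.
Import numFieldNormedType.Exports.
Local Open Scope classical_set_scope.

Lemma ceil_half (R : realType) (nu : nat) :
  Num.ceil (nu%:R / 2 : R) = (uphalf nu)%:Z.
Proof.
have nuE : nu%:R = (uphalf nu)%:R * 2 - (odd nu)%:R :> R.
  by rewrite -natrM -natrB; [congr _%:R; lia | lia].
apply: ceil_def; rewrite intrB -!pmulrn nuE.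
by case: (odd nu) => /=; lra.
Qed.

(** With x = nu and y = ceil(nu / 2), rounding gives 0 <= 2 y - x <= 1, so the
    difference of the two terms is at most 1 / (4 x y), which is at most
    e / (2 x) as soon as x >= 1 / e. *)
Lemma half_ceil_equiv (R : realType) :
  (fun nu : nat => 1 / (4 * (Num.ceil (nu%:R / 2 : R))%:~R) : R)
    ~_ \oo (fun nu : nat => 1 / (2 * nu%:R) : R).
Proof.
apply/eqaddoP => e e0; near=> nu.
rewrite -[(_ - _) nu]/(1 / (4 * (Num.ceil (nu%:R / 2 : R))%:~R)
                       - 1 / (2 * nu%:R)).
rewrite ceil_half -pmulrn.
set x : R := nu%:R; set y : R := (uphalf nu)%:R.
have x0 : 0 < x by rewrite ltr0n; near: nu; exists 1%N.
have ex : 1 <= e * x.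
  by rewrite mulrC -ler_pdivrMr // /x; near: nu; exact: nbhs_infty_ger.
have [xy yx] : x <= 2 * y /\ 2 * y <= x + 1.
  by rewrite /x /y -natrM natr1 !ler_nat; split; lia.
have y0 : 0 < y by lra.
have dE : 1 / (2 * x) - 1 / (4 * y) = (2 * y - x) / (4 * x * y).
  by field; rewrite !gt_eqF.
have d0 : 0 <= (2 * y - x) / (4 * x * y).
  by rewrite divr_ge0 ?subr_ge0 // !mulr_ge0 // ltW.
rewrite distrC dE ger0_norm // gtr0_norm ?divr_gt0 ?mulr_gt0 // -subr_ge0.
have -> : e * (1 / (2 * x)) - (2 * y - x) / (4 * x * y)
          = (e * (2 * y) - (2 * y - x)) / (4 * x * y).
  by field; rewrite !gt_eqF.
have exy : e * x <= e * (2 * y) by rewrite ler_pM2l.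
by rewrite divr_ge0 ?mulr_ge0 ?(ltW x0) ?(ltW y0) // subr_ge0; lra.
Unshelve. all: by end_near.
Qed.

Theorem corollary2p4 (R : realType) :
  (forall I : instance R 3 2,
     let nu := strong_chromatic_number I in
     (3 <= nu)%N ->
     opt I <> wor I ->
     1 / (4 * (Num.ceil (nu%:R / 2 : R))%:~R) <= average_differential_ratio I)
  /\
  (fun nu : nat => 1 / (4 * (Num.ceil (nu%:R / 2 : R))%:~R) : R)
    ~_ \oo (fun nu : nat => 1 / (2 * nu%:R) : R).
Proof.
split=> [I nu nu3 opt_wor|]; last exact: half_ceil_equiv.
have colorable : strongly_colorable I nu.
  by rewrite /nu /strong_chromatic_number; case: ex_minnP.
by rewrite ceil_half; apply: (ratio_ge _ colorable) => //; lia.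
Qed.
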